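(* Let $M=(M,\phi,\xi,\eta,g)$ be a $(2n+1)$-dimensional almost contact metric manifold, with Levi-Civita connection $\nabla$, and let $h=\frac12 L_\xi\phi$. Then $M$ is a contact metric manifold if and only if the following two conditions hold: (i) $h$ is symmetric with respect to $g$, i.e. $g(hX,Y)=g(X,hY)$ for all $X,Y\in\mathfrak{X}(M)$; (ii) for all $X,Y\in\mathfrak{X}(M)$, $$(\nabla_X\phi)Y+(\nabla_{\phi X}\phi)\phi Y=2g(X,Y)\xi-\eta(Y)X-\eta(X)\eta(Y)\xi-\eta(Y)hX.$$
   Context: $\mathfrak{X}(M)$ denotes the smooth vector fields on $M$. An almost contact metric manifold $(M,\phi,\xi,\eta,g)$ is a smooth manifold $M$ of dimension $2n+1$ with a $(1,1)$-tensor field $\phi$, a vector field $\xi$, a 1-form $\eta$ and a Riemannian metric $g$ such that, for all $X,Y\in\mathfrak{X}(M)$, $\phi^2X=-X+\eta(X)\xi$, $\phi\xi=0$, $\eta\circ\phi=0$, $\eta(\xi)=1$, $g(\phi X,\phi Y)=g(X,Y)-\eta(X)\eta(Y)$ and $\eta(X)=g(\xi,X)$. It is a contact metric manifold if in addition $d\eta(X,Y)=g(X,\phi Y)$ for all $X,Y\in\mathfrak{X}(M)$, with the convention $d\eta(X,Y)=\frac12\big(X(\eta(Y))-Y(\eta(X))-\eta([X,Y])\big)=\frac12\big((\nabla_X\eta)(Y)-(\nabla_Y\eta)(X)\big)$ (this forces $\eta\wedge(d\eta)^n\neq0$ everywhere). $L_\xi$ is the Lie derivative, so $(L_\xi\phi)X=[\xi,\phi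 X]-\phi[\xi,X]$. *)

(* Defs.v *)
From HB Require Import structures.
From mathcomp Require Import all_boot all_order all_algebra.
From mathcomp Require Import all_classical all_reals all_analysis.
From mathcomp Require Import ring.

Set Implicit Arguments.
Unset Strict Implicit.
Unset Printing Implicit Defensive.

Import Order.TTheory GRing.Theory Num.Theory.
Import numFieldNormedType.Exports.

Local Open Scope classical_set_scope.
Local Open Scope ring_scope.

Section SmoothOn.
Context {R : realType} {m : nat}.
Implicit Types (U : set 'rV[R]_m) (f g : 'rV[R]_m -> R).

Definition ipartial (s : seq 'I_m) f : 'rV[R]_m -> R :=
  foldr (fun i g => 'D_(delta_mx 0 i) g) f s.

Definition regular_on U f :=
  forall x, U x ->
    {for x, continuous f} /\ forall i, derivable f x (delta_mx 0 i).

(* [U] is meant to be open: derivatives are taken in the ambient space. *)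
Definition smooth_on U f := forall s, regular_on U (ipartial s f).

Let ck_on k U f := forall s, (size s <= k)%N -> regular_on U (ipartial s f).

Lemma near_open U (P : 'rV[R]_m -> Prop) x :
  open U -> U x -> (forall y, U y -> P y) -> \forall y \near x, P y.
Proof. by move=> oU Ux UP; apply: filterS UP _; exact: open_nbhs_nbhs. Qed.

Lemma regular_on_eq U f g : open U -> (forall x, U x -> f x = g x) ->
  regular_on U f -> regular_on U g.
Proof.
move=> oU fg rf x Ux; have [cf df] := rf x Ux.
have nfg : \forall y \near x, f y = g y by exact: near_open fg.
split=> [|i]; last exact: near_eq_derivable nfg (df i).
rewrite /prop_for /continuous_at -(fg x Ux).
exact: (cvg_trans (near_eq_cvg (F := nbhs x) nfg) cf).
Qed.

Lemma ipartial_eq U f g s : open U -> (forall x, U x -> f x = g x) ->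
  forall x, U x -> ipartial s f x = ipartial s g x.
Proof.
move=> oU fg; elim: s => [|i s IH] //= x Ux.
by apply: near_eq_derive; exact: near_open IH.
Qed.

Lemma ipartial_rcons s i f :
  ipartial (rcons s i) f = ipartial s ('D_(delta_mx 0 i) f).
Proof. by rewrite /ipartial foldr_rcons. Qed.

Lemma regular_onD U f g : regular_on U f -> regular_on U g ->
  regular_on U (f \+ g).
Proof.
move=> rf rg x Ux; have [cf df] := rf x Ux; have [cg dg] := rg x Ux.
split=> [|i]; first exact: continuousD.
exact: derivableD.
Qed.

Lemma regular_onM U f g : regular_on U f -> regular_on U g ->
  regular_on U (f \* g).
Proof.
move=> rf rg x Ux; have [cf df] := rf x Ux; have [cg dg] := rg x Ux.
split=> [|i]; first exact: continuousM.
exact: derivableM.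
Qed.

Lemma ipartialD U f g k s : open U -> ck_on k U f -> ck_on k U g ->
  (size s <= k.+1)%N -> forall x, U x ->
  ipartial s (f \+ g) x = ipartial s f x + ipartial s g x.
Proof.
move=> oU cf cg; elim: s => [|i s IH] //= sk x Ux.
have {}IH := IH (ltnW sk).
transitivity ('D_(delta_mx 0 i) (ipartial s f \+ ipartial s g) x).
  by apply: near_eq_derive; exact: near_open IH.
by apply: deriveD; [exact: (cf s sk x Ux).2|exact: (cg s sk x Ux).2].
Qed.

Lemma ck_onD U f g k : open U -> ck_on k U f -> ck_on k U g ->
  ck_on k U (f \+ g).
Proof.
move=> oU cf cg s sk.
apply: (@regular_on_eq _ (ipartial s f \+ ipartial s g)) => //.
  by move=> x Ux; rewrite (ipartialD oU cf cg (leqW sk)).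
by apply: regular_onD; [exact: cf|exact: cg].
Qed.

Lemma ck_onM U k f g : open U -> smooth_on U f -> smooth_on U g ->
  ck_on k U (f \* g).
Proof.
move=> oU; elim: k f g => [|k IH] f g sf sg s.
  by rewrite leqn0 size_eq0 => /eqP ->; apply: regular_onM; [exact: (sf [::])|exact: (sg [::])].
case/lastP: s => [_|s i].
  by apply: regular_onM; [exact: (sf [::])|exact: (sg [::])].
rewrite size_rcons ltnS => sk; rewrite ipartial_rcons.
have sD h j : smooth_on U h -> smooth_on U ('D_(delta_mx 0 j) h).
  by move=> sh t; rewrite -ipartial_rcons; exact: sh.
have c : ck_on k U ((f \* 'D_(delta_mx 0 i) g) \+ (g \* 'D_(delta_mx 0 i) f)).
  apply: ck_onD oU _ _.
    by apply: IH sf _; exact: sD.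
  by apply: IH sg _; exact: sD.
apply: regular_on_eq (c s sk) => //.
apply: ipartial_eq => // x Ux; rewrite deriveM//.
- exact: (sf [::] x Ux).2.
- exact: (sg [::] x Ux).2.
Qed.

Lemma smooth_onD U f g : open U -> smooth_on U f -> smooth_on U g ->
  smooth_on U (f \+ g).
Proof.
move=> oU sf sg s; apply: (ck_onD (k := size s) oU _ _ (leqnn _)) => t _.
  exact: sf.
exact: sg.
Qed.

Lemma smooth_onM U f g : open U -> smooth_on U f -> smooth_on U g ->
  smooth_on U (f \* g).
Proof. by move=> oU sf sg s; exact: (ck_onM (k := size s) oU sf sg). Qed.

Lemma smooth_on_cst U a : smooth_on U (cst a).
Proof.
have r b : regular_on U (cst b).
  by move=> x _; split=> [|i]; [exact: cst_continuous|exact: derivable_cst].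
move=> s; suff [b ->] : exists b, ipartial s (cst a) = cst b by [].
elim: s => [|i s [b IH]]; first by exists a.
by exists 0; rewrite /= -/(ipartial s _) IH; apply/funext => x; rewrite derive_cst.
Qed.

End SmoothOn.

(* The values of [chart_map] outside [chart_dom], and of [chart_inv] outside
   the image of [chart_dom], are irrelevant. *)
Record chart (R : realType) (m : nat) (M : topologicalType) := Chart {
  chart_dom : set M;
  chart_map : M -> 'rV[R]_m;
  chart_inv : 'rV[R]_m -> M;
  chart_dom_open : open chart_dom;
  chart_im_open : open (chart_map @` chart_dom);
  chart_mapK : forall p, chart_dom p -> chart_inv (chart_map p) = p;
  chart_map_continuous :
    forall p, chart_dom p -> {for p, continuous chart_map};
  chart_inv_continuous :
    forall x, (chart_map @` chart_dom) x -> {for x, continuous chart_inv} }.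

(* The atlas need not be maximal: it determines the smooth functions. *)
Record manifold (R : realType) (m : nat) := Manifold {
  carrier :> topologicalType;
  atlas : set (chart R m carrier);
  manifold_hausdorff : hausdorff_space carrier;
  manifold_second_countable : @second_countable carrier;
  atlas_cover : forall p, exists2 c, atlas c & chart_dom c p;
  atlas_compat : forall c c', atlas c -> atlas c' -> forall j,
    smooth_on (chart_map c @` (chart_dom c `&` chart_dom c'))
      (fun x => chart_map c' (chart_inv c x) 0 j) }.

Section SmoothFunctions.
Context {R : realType} {m : nat}.
Variable M : manifold R m.

Definition smooth : {pred (M -> R)} := fun f => `[<
  forall c, atlas c -> smooth_on (chart_map c @` chart_dom c) (f \o chart_inv c)>].

Lemma smooth_cst a : cst a \in smooth.
Proof. by apply/asboolP => c _; exact: smooth_on_cst. Qed.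

Lemma smooth_subring : subring_closed smooth.
Proof.
have sD (f g : M -> R) : f \in smooth -> g \in smooth -> f + g \in smooth.
  move=> /asboolP sf /asboolP sg; apply/asboolP => c ac.
  by apply: smooth_onD (sf c ac) (sg c ac); exact: chart_im_open.
have sM (f g : M -> R) : f \in smooth -> g \in smooth -> f * g \in smooth.
  move=> /asboolP sf /asboolP sg; apply/asboolP => c ac.
  by apply: smooth_onM (sf c ac) (sg c ac); exact: chart_im_open.
split; [exact: smooth_cst|move=> f g sf sg|exact: sM].
rewrite (_ : f - g = f + cst (-1) * g).
  by apply: (sD _ _ sf); apply: sM sg; exact: smooth_cst.
by apply/funext => p; change (f p - g p = f p + -1 * g p); rewrite mulN1r.
Qed.

Record Cinf := MkCinf { cinf_fun :> M -> R; cinfP : cinf_fun \in smooth }.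

HB.instance Definition _ := [isSub for cinf_fun].
HB.instance Definition _ := [Choice of Cinf by <:].
HB.instance Definition _ :=
  GRing.SubChoice_isSubComPzRing.Build (M -> R) smooth Cinf smooth_subring.

Definition cinf_cst (a : R) : Cinf := MkCinf (smooth_cst a).

End SmoothFunctions.

Arguments smooth {R m} M.
Arguments cinf_cst {R m} M a.

Section TangentSpaces.
Context {R : realType} {m : nat} {M : manifold R m}.

Definition derivation_at (p : M) : {pred (Cinf M -> R^o)} := fun v => `[<
  (forall a f g, v (cinf_cst M a * f + g) = a * v f + v g) /\
  (forall f g, v (f * g) = f p * v g + g p * v f)>].

Lemma derivation_at_submod p : submod_closed (derivation_at p).
Proof.
split=> [|a v w /asboolP[lv dv] /asboolP[lw dw]]; apply/asboolP; split=> [b f g|f g].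
- by change (0 = b * 0 + 0 :> R); rewrite mulr0 addr0.
- by change (0 = f p * 0 + g p * 0 :> R); rewrite !mulr0 addr0.
- change (a * v (cinf_cst M b * f + g) + w (cinf_cst M b * f + g) =
    b * (a * v f + w f) + (a * v g + w g)).
  by rewrite lv lw; ring.
- change (a * v (f * g) + w (f * g) =
    f p * (a * v g + w g) + g p * (a * v f + w f)).
  by rewrite dv dw; ring.
Qed.

HB.instance Definition _ p := GRing.isSubmodClosed.Build R (Cinf M -> R^o)
  (derivation_at p) (derivation_at_submod p).

Record tangent (p : M) := MkTangent {
  tangent_fun :> Cinf M -> R^o;
  tangentP : tangent_fun \in derivation_at p }.

HB.instance Definition _ p := [isSub for @tangent_fun p].
HB.instance Definition _ p := [Choice of tangent p by <:].
HB.instance Definition _ p := [SubChoice_isSubLmodule of tangent p by <:].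

End TangentSpaces.

Section VectorFields.
Context {R : realType} {m : nat}.
Variable M : manifold R m.

Record vfield := MkVfield {
  vfield_fun :> forall p : M, tangent p;
  vfieldP : forall f : Cinf M, (fun p => vfield_fun p f : R) \in smooth M }.

Definition vder (X : vfield) (f : Cinf M) : Cinf M := MkCinf (vfieldP X f).

HB.instance Definition _ := gen_eqMixin vfield.
HB.instance Definition _ := gen_choiceMixin vfield.

Lemma vfieldE (X Y : vfield) : (forall p, X p = Y p) -> X = Y.
Proof.
case: X => X sX; case: Y => Y sY /= XYp.
have XY : X = Y by exact: functional_extensionality_dep.
by subst Y; congr MkVfield; exact: Prop_irrelevance.
Qed.

Fact vfield0_smooth (f : Cinf M) : (fun p => (0 : tangent p) f : R) \in smooth M.
Proof. exact: (cinfP 0). Qed.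
Definition vfield0 := MkVfield vfield0_smooth.

Fact vfieldN_smooth (X : vfield) (f : Cinf M) : (fun p => (- X p) f : R) \in smooth M.
Proof. exact: (cinfP (- vder X f)). Qed.
Definition vfieldN X := MkVfield (vfieldN_smooth X).

Fact vfieldD_smooth (X Y : vfield) (f : Cinf M) :
  (fun p => (X p + Y p) f : R) \in smooth M.
Proof. exact: (cinfP (vder X f + vder Y f)). Qed.
Definition vfieldD X Y := MkVfield (vfieldD_smooth X Y).

Fact vfieldZ_smooth (a : Cinf M) (X : vfield) (f : Cinf M) :
  (fun p => (a p *: X p) f : R) \in smooth M.
Proof. exact: (cinfP (a * vder X f)). Qed.
Definition vfieldZ a X := MkVfield (vfieldZ_smooth a X).

Fact vfieldDA : associative vfieldD.
Proof. by move=> X Y Z; apply: vfieldE => p; exact: addrA. Qed.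
Fact vfieldDC : commutative vfieldD.
Proof. by move=> X Y; apply: vfieldE => p; exact: addrC. Qed.
Fact vfield0D : left_id vfield0 vfieldD.
Proof. by move=> X; apply: vfieldE => p; exact: add0r. Qed.
Fact vfieldND : left_inverse vfield0 vfieldN vfieldD.
Proof. by move=> X; apply: vfieldE => p; exact: addNr. Qed.

HB.instance Definition _ := GRing.isZmodule.Build vfield
  vfieldDA vfieldDC vfield0D vfieldND.

Fact vfieldZA a b X : vfieldZ a (vfieldZ b X) = vfieldZ (a * b) X.
Proof. by apply: vfieldE => p; exact: scalerA. Qed.
Fact vfield1Z : left_id 1 vfieldZ.
Proof. by move=> X; apply: vfieldE => p; exact: scale1r. Qed.
Fact vfieldZDr : right_distributive vfieldZ +%R.
Proof. by move=> a X Y; apply: vfieldE => p; exact: scalerDr. Qed.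
Fact vfieldZDl X : {morph vfieldZ^~ X : a b / a + b}.
Proof. by move=> a b; apply: vfieldE => p; exact: scalerDl. Qed.

HB.instance Definition _ := GRing.Zmodule_isLmodule.Build (Cinf M) vfield
  vfieldZA vfield1Z vfieldZDr vfieldZDl.

Fact lie_derivation (X Y : vfield) (p : M) :
  (fun f => X p (vder Y f) - Y p (vder X f) : R^o) \in derivation_at p.
Proof.
have vderD (Z : vfield) a f g :
    vder Z (cinf_cst M a * f + g) = cinf_cst M a * vder Z f + vder Z g.
  by apply/val_inj/funext => q; have /asboolP[lin _] := tangentP (Z q); exact: lin.
have vderM (Z : vfield) f g : vder Z (f * g) = f * vder Z g + g * vder Z f.
  by apply/val_inj/funext => q; have /asboolP[_ leib] := tangentP (Z q); exact: leib.
have tanD (Z : vfield) f g : Z p (f + g) = Z p f + Z p g.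
  have /asboolP[lin _] := tangentP (Z p); have := lin 1 f g.
  by rewrite mul1r (_ : cinf_cst M 1 = 1) ?mul1r//; exact: val_inj.
have /asboolP[lX dX] := tangentP (X p); have /asboolP[lY dY] := tangentP (Y p).
apply/asboolP; split=> [a f g|f g].
  by rewrite !vderD lX lY; ring.
rewrite !vderM !tanD !dX !dY /=; ring.
Qed.

Fact lie_smooth (X Y : vfield) (f : Cinf M) :
  (fun p => MkTangent (lie_derivation X Y p) f : R) \in smooth M.
Proof. exact: (cinfP (vder X (vder Y f) - vder Y (vder X f))). Qed.

Definition lie X Y := MkVfield (lie_smooth X Y).

End VectorFields.

Section TensorFields.
Context {R : realType} {m : nat}.
Variable M : manifold R m.

Record tensor11 := MkTensor11 {
  tensor11_fun : forall p : M, {linear tangent p -> tangent p};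
  tensor11_smooth : forall (X : vfield M) (f : Cinf M),
    (fun p => tensor11_fun p (X p) f : R) \in smooth M }.

Definition tensor11_app (F : tensor11) (X : vfield M) : vfield M :=
  MkVfield (tensor11_smooth F X).

Record oneform := MkOneform {
  oneform_fun : forall p : M, {scalar tangent p};
  oneform_smooth : forall X : vfield M,
    (fun p => oneform_fun p (X p) : R) \in smooth M }.

Definition oneform_app (w : oneform) (X : vfield M) : Cinf M :=
  MkCinf (oneform_smooth w X).

Record metric := MkMetric {
  metric_fun : forall p : M, tangent p -> tangent p -> R;
  metric_linear : forall p (w : tangent p), scalar (fun v => metric_fun v w);
  metric_sym : forall p (v w : tangent p), metric_fun v w = metric_fun w v;
  metric_pos : forall p (v : tangent p), v != 0 -> 0 < metric_fun v v;
  metric_smooth : forall X Y : vfield M,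
    (fun p => metric_fun (X p) (Y p)) \in smooth M }.

Definition metric_app (g : metric) (X Y : vfield M) : Cinf M :=
  MkCinf (metric_smooth g X Y).

Record connection := MkConnection {
  connection_fun :> vfield M -> vfield M -> vfield M;
  connectionDl : forall X Y Z,
    connection_fun (X + Y) Z = connection_fun X Z + connection_fun Y Z;
  connectionZl : forall f X Z, connection_fun (f *: X) Z = f *: connection_fun X Z;
  connectionDr : forall X Y Z,
    connection_fun X (Y + Z) = connection_fun X Y + connection_fun X Z;
  connection_leibniz : forall X f Y,
    connection_fun X (f *: Y) = vder X f *: Y + f *: connection_fun X Y }.

End TensorFields.

Coercion tensor11_app : tensor11 >-> Funclass.
Coercion oneform_app : oneform >-> Funclass.
Coercion metric_app : metric >-> Funclass.

Section ContactGeometry.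
Context {R : realType} {m : nat} {M : manifold R m}.
Implicit Types (X Y : vfield M) (phi : tensor11 M) (g : metric M).

Definition levi_civita g (nabla : connection M) :=
  (forall X Y, nabla X Y - nabla Y X = lie X Y) /\
  (forall X Y Z, vder X (g Y Z) = g (nabla X Y) Z + g Y (nabla X Z)).

(* [(nabla_X phi) Y] *)
Definition cov11 (nabla : connection M) phi X Y : vfield M :=
  nabla X (phi Y) - phi (nabla X Y).

(* [(L_X phi) Y] *)
Definition lie11 X phi Y : vfield M := lie X (phi Y) - phi (lie X Y).

(* The normalisation of the exterior derivative has the factor 1/2. *)
Definition dform (w : oneform M) X Y : Cinf M :=
  cinf_cst M 2^-1 * (vder X (w Y) - vder Y (w X) - w (lie X Y)).

End ContactGeometry.

Record almost_contact_metric (R : realType) (n : nat)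
    (M : manifold R (2 * n).+1) := AlmostContactMetric {
  acm_phi : tensor11 M;
  acm_xi : vfield M;
  acm_eta : oneform M;
  acm_g : metric M;
  acm_phi2 : forall X, acm_phi (acm_phi X) = - X + acm_eta X *: acm_xi;
  acm_phi_xi : acm_phi acm_xi = 0;
  acm_eta_phi : forall X, acm_eta (acm_phi X) = 0;
  acm_eta_xi : acm_eta acm_xi = 1;
  acm_g_phi : forall X Y,
    acm_g (acm_phi X) (acm_phi Y) = acm_g X Y - acm_eta X * acm_eta Y;
  acm_eta_g : forall X, acm_eta X = acm_g acm_xi X }.

Definition contact_metric (R : realType) (n : nat) (M : manifold R (2 * n).+1)
    (S : almost_contact_metric M) :=
  forall X Y : vfield M, dform (acm_eta S) X Y = acm_g S X (acm_phi S Y).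

Definition acm_h (R : realType) (n : nat) (M : manifold R (2 * n).+1)
    (S : almost_contact_metric M) (X : vfield M) : vfield M :=
  cinf_cst M 2^-1 *: lie11 (acm_xi S) (acm_phi S) X.

(* Main.v *)
Require Import Defs.
From mathcomp Require Import all_boot all_order all_algebra.
From mathcomp Require Import all_classical all_reals all_analysis.
From mathcomp Require Import ring.
Import Order.TTheory GRing.Theory Num.Theory.
Local Open Scope ring_scope.

(** Write A X = nabla_X xi.  Two identities hold on every almost contact metric
manifold and drive both implications:
- differentiating phi^2 = - id + eta (x) xi along X gives
  g((nabla_X phi) phi Y, Z) = g((nabla_X phi) Y, phi Z)
                              + g(A X, Y) eta(Z) + eta(Y) g(A X, Z);
- torsion-freeness turns the definition of h into
  2 h X = (nabla_xi phi) X - A (phi X) + phi (A X), and that of d eta into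
  2 d eta(X, Y) = g(A X, Y) - g(A Y, X).

Suppose that the manifold is contact.  The fundamental 2-form g(X, phi Y) is
then d eta, hence closed; for the torsion-free connection this says that the
cyclic sum C(X, Y, Z) of g((nabla_X phi) Y, Z) vanishes.  As for almost
Kaehler manifolds, which are quasi-Kaehler, the combination
  C(X, Y, Z) - C(X, phi Y, phi Z) + C(phi X, phi Y, Z) + C(phi X, Y, phi Z)
equals twice g((nabla_X phi) Y + (nabla_{phi X} phi) phi Y, Z) up to terms in
A, phi and eta without derivatives of phi, which come from the first identity.
The antisymmetric part of A is known from d eta; its symmetric part is - phi h,
once nabla_xi phi = 0 is known, and that follows from C(xi, Y, Z) = 0 together
with the first identity for X = xi.  Substituting gives (ii)
([contact_cov11_phi]); the symmetry of h comes out of the same formulas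
([contact_h_sym]).

Conversely, (ii) at Y = xi determines A: it says that A = - phi - phi h.  Hence
A xi = 0, so h anticommutes with phi by the two identities, and the symmetry of
h makes the h-terms of g(A X, Y) - g(A Y, X) cancel, leaving 2 g(X, phi Y)
([contact_of_cov11_phi]). *)

(** * Calculus of smooth functions, vector fields and tensors *)

Section Calculus.
Context {R : realType} {m : nat} {M : manifold R m}.
Implicit Types (f k : Cinf M) (X Y Z : vfield M).

Lemma cinfE f k : (forall p, f p = k p) -> f = k.
Proof. by move=> fk; apply/val_inj/funext. Qed.

(** The ring of smooth functions is not a domain in general; a factor 2 can be
cancelled in it because 2 has an inverse. *)
Lemma half_double f : 2%:R * (cinf_cst M 2^-1 * f) = f.
Proof.
apply: cinfE => p; change ((1 + 1) * (2^-1 * f p) = f p).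
by rewrite mulrA mulfV ?mul1r// (_ : 1 + 1 = 2%:R) ?pnatr_eq0.
Qed.

Lemma double_inj f k : 2%:R * f = 2%:R * k -> f = k.
Proof.
move=> fk; rewrite -(half_double f) -(half_double k).
by rewrite !(mulrCA 2%:R) fk.
Qed.

Lemma vderD X f k : vder X (f + k) = vder X f + vder X k.
Proof.
apply: cinfE => p; have /asboolP[lin _] := tangentP (X p).
have := lin 1 f k; rewrite mul1r (_ : cinf_cst M 1 = 1) ?mul1r//.
exact: val_inj.
Qed.

Lemma vder0 X : vder X 0 = 0.
Proof. by apply: (addrI (vder X 0)); rewrite -vderD !addr0. Qed.

Lemma vderN X f : vder X (- f) = - vder X f.
Proof. by apply/eqP; rewrite -addr_eq0 -vderD addNr vder0. Qed.

Lemma vderB X f k : vder X (f - k) = vder X f - vder X k.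
Proof. by rewrite vderD vderN. Qed.

Lemma vderM X f k : vder X (f * k) = f * vder X k + k * vder X f.
Proof.
by apply: cinfE => p; have /asboolP[_ leib] := tangentP (X p); exact: leib.
Qed.

Lemma vder1 X : vder X 1 = 0.
Proof.
by apply: (addrI (vder X 1)); rewrite addr0 -[in RHS](mulr1 1) vderM !mul1r.
Qed.

Lemma vder_half X f :
  vder X (cinf_cst M 2^-1 * f) = cinf_cst M 2^-1 * vder X f.
Proof.
have dbl k : 2%:R * k = k + k by ring.
by apply: double_inj; rewrite half_double dbl -vderD -dbl half_double.
Qed.

Lemma vder_lie X Y f : vder (lie X Y) f = vder X (vder Y f) - vder Y (vder X f).
Proof. exact: cinfE. Qed.

Lemma vder_inj X Y : (forall f, vder X f = vder Y f) -> X = Y.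
Proof.
move=> XY; apply: vfieldE => p; apply/val_inj/funext => f.
exact: (congr1 (fun k : Cinf M => k p) (XY f)).
Qed.

Lemma lie_jacobi X Y Z :
  lie (lie X Y) Z + lie (lie Y Z) X + lie (lie Z X) Y = 0.
Proof.
apply: vder_inj => f; transitivity (0 : Cinf M); last exact: cinfE.
transitivity (vder (lie (lie X Y) Z) f + vder (lie (lie Y Z) X) f
  + vder (lie (lie Z X) Y) f); first exact: cinfE.
by rewrite !vder_lie !vderB; ring.
Qed.

Lemma oneformD (w : oneform M) X Y : w (X + Y) = w X + w Y.
Proof. by apply: cinfE => p; exact: linearD. Qed.

Lemma oneform0 (w : oneform M) : w 0 = 0.
Proof. by apply: cinfE => p; exact: linear0. Qed.

(** This is d (d w) = 0: second derivatives cancel because the bracket is the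
commutator of derivations, and the iterated brackets by the Jacobi identity. *)
Lemma dform_closed (w : oneform M) X Y Z :
  vder X (dform w Y Z) + vder Y (dform w Z X) + vder Z (dform w X Y)
  = dform w (lie X Y) Z + dform w (lie Y Z) X + dform w (lie Z X) Y.
Proof.
have J : w (lie (lie X Y) Z) = - w (lie (lie Y Z) X) - w (lie (lie Z X) Y).
  apply/eqP; rewrite -opprD -addr_eq0 addrA -!oneformD lie_jacobi.
  by rewrite oneform0.
by rewrite /dform !vder_half !vderB !vder_lie J; ring.
Qed.

Variable phi : tensor11 M.

Lemma tensor11D X Y : phi (X + Y) = phi X + phi Y.
Proof. by apply: vfieldE => p; exact: linearD. Qed.

Lemma tensor11N X : phi (- X) = - phi X.
Proof. by apply: vfieldE => p; exact: linearN. Qed.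

Lemma tensor11_0 : phi 0 = 0.
Proof. by apply: vfieldE => p; exact: linear0. Qed.

Variable nabla : connection M.

Lemma nabla0l X : nabla 0 X = 0.
Proof. by apply: (addrI (nabla 0 X)); rewrite -connectionDl !addr0. Qed.

Lemma nabla0r X : nabla X 0 = 0.
Proof. by apply: (addrI (nabla X 0)); rewrite -connectionDr !addr0. Qed.

Lemma nablaNl X Y : nabla (- X) Y = - nabla X Y.
Proof. by rewrite -!scaleN1r connectionZl. Qed.

Lemma nablaNr X Y : nabla X (- Y) = - nabla X Y.
Proof. by apply/eqP; rewrite -addr_eq0 -connectionDr addNr nabla0r. Qed.

Variable g : metric M.

Lemma metricC X Y : g X Y = g Y X.
Proof. by apply: cinfE => p; exact: Defs.metric_sym. Qed.

Lemma metric_linearl f X Y Z : g (f *: X + Y) Z = f * g X Z + g Y Z.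
Proof.
by apply: cinfE => p; exact: (metric_linear g (Z p) (f p) (X p) (Y p)).
Qed.

Lemma metricDl X Y Z : g (X + Y) Z = g X Z + g Y Z.
Proof. by have := metric_linearl 1 X Y Z; rewrite scale1r mul1r. Qed.

Lemma metric0l Z : g 0 Z = 0.
Proof. by apply: (addrI (g 0 Z)); rewrite -metricDl !addr0. Qed.

Lemma metricZl f X Z : g (f *: X) Z = f * g X Z.
Proof. by have := metric_linearl f X 0 Z; rewrite metric0l !addr0. Qed.

Lemma metricNl X Z : g (- X) Z = - g X Z.
Proof. by rewrite -scaleN1r metricZl mulN1r. Qed.

Lemma metricDr X Y Z : g Z (X + Y) = g Z X + g Z Y.
Proof. by rewrite !(metricC Z) metricDl. Qed.

Lemma metric0r Z : g Z 0 = 0.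
Proof. by rewrite metricC metric0l. Qed.

Lemma metricZr f X Z : g Z (f *: X) = f * g Z X.
Proof. by rewrite !(metricC Z) metricZl. Qed.

Lemma metricNr X Z : g Z (- X) = - g Z X.
Proof. by rewrite !(metricC Z) metricNl. Qed.

Definition metricE := (metricDl, metricDr, metricNl, metricNr,
  metricZl, metricZr, metric0l, metric0r).

(** Testing the difference of the two fields against itself reduces this to
positivity at each point, without any local frame. *)
Lemma metric_inj X Y : (forall Z, g X Z = g Y Z) -> X = Y.
Proof.
move=> XY; apply/eqP; rewrite -subr_eq0; apply/eqP/vfieldE => p.
apply/eqP; case: eqP => //= /eqP /(metric_pos g).
have -> : metric_fun g ((X - Y) p) ((X - Y) p) = g (X - Y) (X - Y) p by [].
by rewrite metricDl metricNl XY subrr ltxx.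
Qed.

End Calculus.

(** Deduces an equation from another one with which it agrees up to a ring
identity; successive applications use a sum of equations. *)
Lemma eq_by_sub {V : zmodType} {a b c d : V} :
  c = d -> a - b = c - d -> a = b.
Proof. by move=> -> /eqP; rewrite subrr subr_eq0 => /eqP. Qed.

(** * Almost contact metric manifolds *)

Section AlmostContactMetric.
Context {R : realType} {n : nat} {M : manifold R (2 * n).+1}.
Variables (S : almost_contact_metric M) (nabla : connection M).
Hypothesis nabla_LC : levi_civita (acm_g S) nabla.

Local Notation phi := (acm_phi S).
Local Notation xi := (acm_xi S).
Local Notation eta := (acm_eta S).
Local Notation g := (acm_g S).
Local Notation h := (acm_h S).
Local Notation A X := (nabla X xi).
Implicit Types X Y Z : vfield M.

Lemma xi_g X : g xi X = eta X.
Proof. by rewrite acm_eta_g. Qed.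

Lemma g_xi X : g X xi = eta X.
Proof. by rewrite metricC xi_g. Qed.

Lemma phi_skew X Y : g (phi X) Y = - g X (phi Y).
Proof.
have := acm_g_phi S X (phi Y).
rewrite acm_phi2 !metricE g_xi !acm_eta_phi !mulr0 subr0 addr0 => <-.
by rewrite opprK.
Qed.

Lemma metric_compat X Y Z :
  vder X (g Y Z) = g (nabla X Y) Z + g Y (nabla X Z).
Proof. by case: nabla_LC. Qed.

Lemma torsion_free X Y : lie X Y = nabla X Y - nabla Y X.
Proof. by case: nabla_LC. Qed.

Lemma vder_eta X Y : vder X (eta Y) = g (A X) Y + eta (nabla X Y).
Proof. by rewrite -!xi_g metric_compat. Qed.

(** The field xi has constant length 1. *)
Lemma eta_nabla_xi X : eta (A X) = 0.
Proof.
have E := metric_compat X xi xi; rewrite !xi_g g_xi acm_eta_xi vder1 in E.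
by apply: double_inj; rewrite mulr0 mulr_natl mulr2n -E.
Qed.

(** A constant of its own, so that rewriting with the bilinearity of g does not
expand the difference that defines the covariant derivative. *)
Definition cov_phi X Y Z := g (cov11 nabla phi X Y) Z.

Lemma cov11_phi_xi X : cov11 nabla phi X xi = - phi (A X).
Proof. by rewrite /cov11 acm_phi_xi nabla0r sub0r. Qed.

(** The endomorphism phi is skew for g and g is parallel. *)
Lemma cov_phi_skew X Y Z : cov_phi X Z Y = - cov_phi X Y Z.
Proof.
have E1 := metric_compat X (phi Y) Z.
have E2 := metric_compat X Y (phi Z).
rewrite phi_skew vderN in E1.
rewrite (metricC _ Y (nabla X _)) in E2; rewrite (metricC _ (phi Y)) in E1.
have E : g (nabla X (phi Z)) Y = vder X (g Y (phi Z)) - g (nabla X Y) (phi Z).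
  by rewrite E2; ring.
have {}E1 : vder X (g Y (phi Z)) =
    - g (nabla X (phi Y)) Z - g (nabla X Z) (phi Y).
  by rewrite -opprD -E1 opprK.
by rewrite /cov_phi /cov11 !metricE !phi_skew E E1; ring.
Qed.

(** This is the covariant derivative of phi^2 = - id + eta (x) xi. *)
Lemma cov_phi_phi X Y Z :
  cov_phi X (phi Y) Z =
  cov_phi X Y (phi Z) + g (A X) Y * eta Z + eta Y * g (A X) Z.
Proof.
rewrite /cov_phi /cov11 acm_phi2 connectionDr nablaNr connection_leibniz.
rewrite !metricE vder_eta !phi_skew acm_phi2 !metricE !xi_g !g_xi; ring.
Qed.

Lemma lie_phi X :
  lie11 xi phi X = cov11 nabla phi xi X - nabla (phi X) xi + phi (A X).
Proof.
rewrite /lie11 /cov11 !torsion_free tensor11D tensor11N opprB.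
by rewrite addrA addrAC (addrAC (nabla xi _)).
Qed.

Lemma double_g_h X Z :
  2%:R * g (h X) Z = cov_phi xi X Z - g (A (phi X)) Z - g (A X) (phi Z).
Proof.
by rewrite metricZl half_double lie_phi 2!metricDl metricNl (phi_skew (A X)).
Qed.

Lemma g_h_xi Z : g (h xi) Z = 0.
Proof.
apply: double_inj; rewrite double_g_h /cov_phi cov11_phi_xi acm_phi_xi nabla0l.
by rewrite !metricE phi_skew; ring.
Qed.

(** In other words h phi = - phi h, since phi is skew.  When xi is geodesic, eta
is invariant under its flow, hence so is phi^2 = - id + eta (x) xi; the Lie
derivative of phi^2 is 2 (h phi + phi h). *)
Lemma g_h_phi Y Z : A xi = 0 -> g (h (phi Y)) Z = g (h Y) (phi Z).
Proof.
move=> A_xi; apply: double_inj; rewrite !double_g_h cov_phi_phi !acm_phi2.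
rewrite connectionDl nablaNl connectionZl A_xi !metricE g_xi eta_nabla_xi.
ring.
Qed.

Lemma double_dform_eta X Y :
  2%:R * dform eta X Y = g (A X) Y - g (A Y) X.
Proof.
rewrite /dform half_double !vder_eta torsion_free -!xi_g !metricE; ring.
Qed.

Lemma cov_phi_phi_phi X Y Z :
  cov_phi X (phi Y) (phi Z) =
  - cov_phi X Y Z + eta Y * g (A X) (phi Z) - eta Z * g (A X) (phi Y).
Proof.
rewrite cov_phi_phi acm_phi2 acm_eta_phi /cov_phi metricDr metricNr metricZr.
rewrite -/(cov_phi X Y xi) (cov_phi_skew X xi Y) /cov_phi cov11_phi_xi.
by rewrite metricNl phi_skew; ring.
Qed.

(** * Consequences of the contact condition *)

Section Contact.
Hypothesis contact : contact_metric S.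

Lemma contact_nabla_xi_swap X Y : g (A X) Y = g (A Y) X + 2%:R * g X (phi Y).
Proof. by rewrite -contact double_dform_eta; ring. Qed.

Lemma contact_nabla_xi_xi : A xi = 0.
Proof.
apply: (metric_inj g) => Y.
rewrite contact_nabla_xi_swap g_xi eta_nabla_xi xi_g acm_eta_phi metric0l.
by rewrite mulr0 addr0.
Qed.

(** The fundamental 2-form is exact, hence closed, and a torsion-free connection
may replace the bracket in its exterior derivative. *)
Lemma contact_cov_phi_cyclic X Y Z :
  cov_phi X Y Z + cov_phi Y Z X + cov_phi Z X Y = 0.
Proof.
(* The connection terms on the right cancel in the cyclic sum. *)
have D U V W : vder U (dform eta V W) - dform eta (lie U V) W =
    cov_phi U W V + g (nabla V U) (phi W) - g (nabla U W) (phi V).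
  rewrite !contact metric_compat torsion_free /cov_phi /cov11 !metricE.
  rewrite (metricC _ V) phi_skew; ring.
rewrite (cov_phi_skew X Z) (cov_phi_skew Y X) (cov_phi_skew Z Y).
apply: (eq_by_sub (esym (dform_closed eta X Y Z))).
apply: (eq_by_sub (D X Y Z)); apply: (eq_by_sub (D Y Z X)).
by apply: (eq_by_sub (D Z X Y)); ring.
Qed.

Lemma contact_cov_phi_along_xi Y Z :
  cov_phi xi Y Z = g (A Y) (phi Z) - g (A Z) (phi Y).
Proof.
have := contact_cov_phi_cyclic xi Y Z.
rewrite (cov_phi_skew Y xi Z) {2 3}/cov_phi !cov11_phi_xi !metricE !phi_skew.
by move=> E; apply: (eq_by_sub E); ring.
Qed.

(** Given [contact_cov_phi_along_xi], this is nabla_xi phi = 0.  Since xi is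
geodesic, nabla_xi phi anticommutes with phi; expressed through A, this says
that phi reverses the sign of the symmetric part s of A, and then
s(Y, phi Z) = s(phi Y, Z). *)
Lemma contact_nabla_xi_phi Y Z : g (A Y) (phi Z) = g (A Z) (phi Y).
Proof.
(* The symmetric part of A changes sign under phi. *)
have E U V : g (A (phi U)) (phi V) + g (A (phi V)) (phi U)
    = - (g (A U) V + g (A V) U).
  have := cov_phi_phi xi U V.
  rewrite !contact_cov_phi_along_xi !contact_nabla_xi_xi !acm_phi2 !metricE.
  by rewrite !g_xi !eta_nabla_xi => E; apply: (eq_by_sub E); ring.
apply: double_inj.
have := E (phi Y) Z; rewrite acm_phi2 connectionDl nablaNl connectionZl.
rewrite contact_nabla_xi_xi !metricE !g_xi !eta_nabla_xi.
rewrite (contact_nabla_xi_swap (phi Y) Z) (contact_nabla_xi_swap (phi Z) Y).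
rewrite (metricC _ (phi Z)) => E'.
by apply: (eq_by_sub (esym E')); ring.
Qed.

Lemma contact_double_g_h X Z :
  2%:R * g (h X) Z = - (g (A X) (phi Z) + g (A (phi X)) Z).
Proof.
rewrite double_g_h contact_cov_phi_along_xi (contact_nabla_xi_phi X Z); ring.
Qed.

Lemma contact_h_sym X Y : g (h X) Y = g X (h Y).
Proof.
apply: double_inj; rewrite (metricC _ X) !contact_double_g_h.
rewrite (contact_nabla_xi_swap (phi X)) (contact_nabla_xi_swap (phi Y)).
by rewrite (metricC _ (phi Y)) (contact_nabla_xi_phi X Y).
Qed.

(** A signed sum of four cyclic identities leaves twice the left-hand side and
terms in A and eta.  The coefficients of eta(X) and eta(Z) in them involve
only the antisymmetric part of A, hence only g and eta; that of eta(Y) also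
contains h. *)
Lemma contact_g_cov_phi X Y Z :
  cov_phi X Y Z + cov_phi (phi X) (phi Y) Z =
  2%:R * g X Y * eta Z - eta Y * g X Z - eta X * eta Y * eta Z
    - eta Y * g (h X) Z.
Proof.
have C1 := contact_cov_phi_cyclic X Y Z.
have C2 := contact_cov_phi_cyclic X (phi Y) (phi Z).
have C3 := contact_cov_phi_cyclic (phi X) (phi Y) Z.
have C4 := contact_cov_phi_cyclic (phi X) Y (phi Z).
rewrite cov_phi_phi_phi cov_phi_phi in C2.
rewrite cov_phi_phi_phi !cov_phi_phi in C3.
rewrite cov_phi_phi_phi cov_phi_phi in C4.
rewrite cov_phi_phi; apply: double_inj.
(* The coefficient of eta(Y) is where the symmetric part of A, that is h,
   enters. *)
have H := congr1 ( *%R (eta Y)) (contact_double_g_h X Z).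
rewrite (contact_nabla_xi_phi X Z) in H.
have AXY := contact_nabla_xi_swap X (phi Y).
have AXZ := contact_nabla_xi_swap X (phi Z).
have AYX := contact_nabla_xi_swap Y (phi X).
have AYZ := contact_nabla_xi_swap Y (phi Z).
have AZX := contact_nabla_xi_swap Z (phi X).
have AZY := contact_nabla_xi_swap Z (phi Y).
rewrite !acm_phi2 !metricE !g_xi in AXY AXZ AYX AYZ AZX AZY.
rewrite (metricC _ Y X) in AYX.
rewrite (metricC _ Z X) in AZX.
rewrite (metricC _ Z Y) in AZY.
apply: (eq_by_sub C1); apply: (eq_by_sub (esym C2)).
apply: (eq_by_sub C3); apply: (eq_by_sub C4); apply: (eq_by_sub H).
ring: AXY AXZ AYX AYZ AZX AZY.
Qed.

Lemma contact_cov11_phi X Y :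
  cov11 nabla phi X Y + cov11 nabla phi (phi X) (phi Y)
  = (2%:R * g X Y) *: xi - eta Y *: X - (eta X * eta Y) *: xi - eta Y *: h X.
Proof.
apply: (metric_inj g) => Z.
transitivity (cov_phi X Y Z + cov_phi (phi X) (phi Y) Z).
  exact: metricDl.
by rewrite contact_g_cov_phi 3!metricDl 3!metricNl 4!metricZl xi_g.
Qed.

End Contact.

(** * Recovering the contact condition *)

(** At Y = xi the term (nabla_{phi X} phi) phi Y drops out, as phi vanishes on
xi, and the term (nabla_X phi) Y is - phi (A X); so A is determined by phi and
h, and with it d eta, which is the antisymmetric part of A. *)
Lemma contact_of_cov11_phi :
  (forall X Y, g (h X) Y = g X (h Y)) ->
  (forall X Y, cov11 nabla phi X Y + cov11 nabla phi (phi X) (phi Y)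
     = (2%:R * g X Y) *: xi - eta Y *: X - (eta X * eta Y) *: xi
       - eta Y *: h X) ->
  contact_metric S.
Proof.
move=> h_sym cov_phi_eq X Y.
(* Pairing with phi V amounts to applying phi, which recovers A U from
   phi (A U) because A U is orthogonal to xi. *)
have A_h U V : g (A U) V = g U (phi V) + g (h U) (phi V).
  have := congr1 (fun W => g W (phi V)) (cov_phi_eq U xi).
  rewrite metricDl cov11_phi_xi acm_phi_xi /cov11.
  rewrite tensor11_0 !nabla0r tensor11_0 acm_eta_xi !metricE.
  rewrite !(xi_g, acm_eta_phi).
  rewrite phi_skew acm_phi2 !metricE g_xi eta_nabla_xi.
  by move=> E; apply: (eq_by_sub (esym E)); ring.
have A_xi : A xi = 0.
  apply: (metric_inj g) => V; rewrite metric0l.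
  by rewrite A_h xi_g acm_eta_phi g_h_xi addr0.
have h_swap : g (h Y) (phi X) = g (h X) (phi Y).
  by rewrite -g_h_phi // h_sym metricC h_sym.
apply: double_inj; rewrite double_dform_eta !A_h h_swap.
by rewrite (metricC _ Y) phi_skew; ring.
Qed.

End AlmostContactMetric.

Theorem theorem3p2 (R : realType) (n : nat) (M : manifold R (2 * n).+1)
    (S : almost_contact_metric M) (nabla : connection M)
    (nabla_LC : levi_civita (acm_g S) nabla) :
  let phi := acm_phi S in
  let xi := acm_xi S in
  let eta := acm_eta S in
  let g := acm_g S in
  let h := acm_h S in
  contact_metric S <->
  (forall X Y : vfield M, g (h X) Y = g X (h Y)) /\
  (forall X Y : vfield M,
     cov11 nabla phi X Y + cov11 nabla phi (phi X) (phi Y)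
     = (2%:R * g X Y) *: xi - eta Y *: X - (eta X * eta Y) *: xi
       - eta Y *: h X).
Proof.
move=> phi xi eta g h; split=> [contact|[h_sym cov_phi_eq]].
  split; first exact: (contact_h_sym S nabla).
  exact: contact_cov11_phi.
exact: (contact_of_cov11_phi S nabla).
Qed.
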